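(* Suppose that vectors $v_1,\dots,v_m\in\mathbb{Z}^n$ are Farkas-related and let integers $a_1\le b_1,\dots,a_m\le b_m$ be given. Then a vector $w\in\mathbb{Z}^n$ can be written as $w=\sum_{i=1}^m x_iv_i$ for some integers $a_1\le x_1\le b_1,\dots,a_m\le x_m\le b_m$ if and only if $w\in\sum_{i=1}^m\mathbb{Z}v_i$ and $$(u,w)\le \sum_{i=1}^m a_i\frac{(u,v_i)-|(u,v_i)|}{2}+\sum_{i=1}^m b_i\frac{(u,v_i)+|(u,v_i)|}{2}$$ for every $\{v_1,\dots,v_m\}$-indecomposable point $[u]\in\mathbb{RP}^{n-1}_+$ (i.e. for every representative $u$ of such a point).
   Context: Vectors $v_1,\dots,v_m\in\mathbb{Z}^n$ are Farkas-related if: for arbitrary integers $a_1\le b_1,\dots,a_m\le b_m$, whenever a vector $w\in\sum_{i=1}^m\mathbb{Z}v_i$ can be written as $w=\sum x_iv_i$ with rational $a_i\le x_i\le b_i$, it can also be written as $w=\sum y_iv_i$ with integers $a_i\le y_i\le b_i$. $(u,v)$ is the standard inner product. $\mathbb{RP}^{n-1}_+$ is the set of equivalence classes of $\mathbb{R}^n\setminus\{0\}$ under $v\sim v'$ iff $v'=rv$ for some real $r>0$; the class of $v$ is $[v]$. Let $W=\sum_{i=1}^m\mathbb{R}v_i$. A nonzero $u\in W$ is $\{v_1,\dots,v_m\}$-decomposable if there exist nonzero $u',u''\in W$ with $u=u'+u''$, $[u']\ne[u]$, $[u'']\ne[u]$, and $(u',v)(u'',v)\ge0$ for every $v\in\{v_1,\dots,v_m\}$;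 otherwise it is $\{v_1,\dots,v_m\}$-indecomposable. A point of $\mathbb{RP}^{n-1}_+$ is $\{v_1,\dots,v_m\}$-indecomposable if it equals $[u]$ for some $\{v_1,\dots,v_m\}$-indecomposable $u\in W$. *)

(* Defs.v *)
From HB Require Import structures.
From mathcomp Require Import all_boot all_order all_algebra.
From mathcomp Require Import generic_quotient boolp reals.

Set Implicit Arguments.
Unset Strict Implicit.
Unset Printing Implicit Defensive.

Import Order.TTheory GRing.Theory Num.Theory.

Local Open Scope ring_scope.
Local Open Scope quotient_scope.

Definition in_int_span (m n : nat) (v : 'I_m -> 'rV[int]_n) (w : 'rV[int]_n)
    : Prop :=
  exists c : 'I_m -> int, w = \sum_(i < m) c i *: v i.

(* A vector of Z^n seen in K^n; used with K = rat and with K = R. *)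
Definition emb (K : pzRingType) (n : nat) (v : 'rV[int]_n) : 'rV[K]_n :=
  map_mx intr v.

Definition farkas_related (m n : nat) (v : 'I_m -> 'rV[int]_n) : Prop :=
  forall a b : 'I_m -> int, (forall i, a i <= b i) ->
  forall w : 'rV[int]_n, in_int_span v w ->
    (exists x : 'I_m -> rat,
       (forall i, (a i)%:~R <= x i <= (b i)%:~R) /\
       emb rat w = \sum_(i < m) x i *: emb rat (v i)) ->
    exists y : 'I_m -> int,
      (forall i, a i <= y i <= b i) /\ w = \sum_(i < m) y i *: v i.

Definition dot (R : realType) (n : nat) (u v : 'rV[R]_n) : R :=
  \sum_(j < n) u 0 j * v 0 j.

Section PositiveProjectiveSpace.
Variables (R : realType) (n : nat).

Definition nzvec : Type := {v : 'rV[R]_n | v != 0}.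

HB.instance Definition _ := Choice.on nzvec.

Definition same_ray (v v' : nzvec) : bool :=
  `[< exists2 r : R, 0 < r & val v' = r *: val v >].

Lemma same_ray_refl : reflexive same_ray.
Proof. by move=> v; apply/asboolP; exists 1; rewrite ?ltr01 ?scale1r. Qed.

Lemma same_ray_sym : symmetric same_ray.
Proof.
suff H v v' : same_ray v v' -> same_ray v' v by move=> v v'; apply/idP/idP; exact: H.
move=> /asboolP[r r0 e]; apply/asboolP; exists r^-1; first by rewrite invr_gt0.
by rewrite e scalerA mulVf ?scale1r // gt_eqF.
Qed.

Lemma same_ray_trans : transitive same_ray.
Proof.
move=> v2 v1 v3 /asboolP[r r0 e] /asboolP[s s0 f]; apply/asboolP.
by exists (s * r); [exact: mulr_gt0 | rewrite f e scalerA].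
Qed.

Canonical same_ray_equiv :=
  EquivRel same_ray same_ray_refl same_ray_sym same_ray_trans.

Definition RPplus : Type := {eq_quot same_ray_equiv}.

HB.instance Definition _ := EqQuotient.on RPplus.

Definition ray_class (v : nzvec) : RPplus := \pi_RPplus v.

End PositiveProjectiveSpace.

(* RP_+^{n-1} is [RPplus R n]. *)
Arguments RPplus R n : clear implicits.
Arguments nzvec R n : clear implicits.

Section Indecomposable.
Variables (R : realType) (m n : nat) (v : 'I_m -> 'rV[int]_n).

Definition real_span : {vspace 'rV[R]_n} := (\sum_(i < m) <[emb R (v i)]>)%VS.

Definition decomposable (u : nzvec R n) : Prop :=
  exists u' u'' : nzvec R n,
    [/\ val u' \in real_span /\ val u'' \in real_span,
        val u = val u' + val u'',
        ray_class u' <> ray_class u,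
        ray_class u'' <> ray_class u &
        forall i, 0 <= dot (val u') (emb R (v i)) * dot (val u'') (emb R (v i))].

Definition indecomposable (u : nzvec R n) : Prop :=
  val u \in real_span /\ ~ decomposable u.

Definition indecomposable_point (p : RPplus R n) : Prop :=
  exists2 u : nzvec R n, indecomposable u & p = ray_class u.

End Indecomposable.

(* Main.v *)
(** The right-hand side of the inequality is the support function h(u) of the
    zonotope of all sums of x_i v_i with a_i <= x_i <= b_i, and the theorem says
    that the indecomposable u already cut this zonotope out of W.  If w is
    in the integral span but not a sum with integral x_i, then, the v_i being
    Farkas-related, it is not one with rational x_i either, so some rational u
    has g(u) := (u, w) - h(u) > 0.  As w is in W, g(u) depends only on the
    projection of u to W.  But g is positively homogeneous, and additive on
    u' + u'' when (u', v_i) and (u'', v_i) never have opposite signs; by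
    induction on the support of ((u, v_i))_i, g <= 0 on indecomposable vectors
    gives g <= 0 on W. *)

Require Import Defs.
From mathcomp Require Import all_boot all_order all_algebra.
From mathcomp Require Import reals.
From mathcomp Require Import generic_quotient boolp ring lra.

Import Order.TTheory GRing.Theory Num.Theory.

Local Open Scope ring_scope.

(** * Fourier-Motzkin elimination over an ordered field *)

Lemma exists_between_seqs {F : realFieldType} (L U : seq F) :
  (forall l u, l \in L -> u \in U -> l <= u) ->
  exists t, (forall l, l \in L -> l <= t) /\ (forall u, u \in U -> t <= u).
Proof.
elim: L => [_|l L IH H].
  suff [t Ht] : exists t, forall u, u \in U -> t <= u by exists t.
  elim: U => [|u U [t Ht]]; first by exists 0.
  exists (Num.min u t) => x; rewrite inE => /predU1P[->|/Ht xt].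
    by rewrite ge_min lexx.
  by rewrite ge_min xt orbT.
have [|t [HL HU]] := IH.
  by move=> x u xL uU; apply: H => //; rewrite inE xL orbT.
exists (Num.max l t); split=> x.
  rewrite inE => /predU1P[->|/HL xt]; first by rewrite le_max lexx.
  by rewrite le_max xt orbT.
by move=> xU; rewrite ge_max HU // H ?inE ?eqxx.
Qed.

Lemma mulmx_delta_col {F : realFieldType} {m} (t : F) (i : 'I_m)
    (x : 'rV[F]_m) (r : 'cV[F]_m) :
  ((x + t *: delta_mx 0 i) *m r) 0 0 = (x *m r) 0 0 + t * r i 0.
Proof. by rewrite mulmxDl -scalemxAl -rowE !mxE. Qed.

(* Fourier-Motzkin elimination: the coordinates of index at least k have
   already been eliminated, and P is any property of inequalities that is
   inherited by their positive combinations. *)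
Lemma fourier_motzkin {F : realFieldType} {m} (P : 'cV[F]_m -> F -> Prop)
    (PD : forall r r' c c', P r c -> P r' c' -> P (r + r') (c + c'))
    (PZ : forall t r c, 0 < t -> P r c -> P (t *: r) (t * c))
    (k : nat) (S : seq ('cV[F]_m * F)) :
  (forall s, s \in S -> P s.1 s.2) ->
  (forall s (i : 'I_m), s \in S -> (k <= i)%N -> s.1 i 0 = 0) ->
  (exists x : 'rV[F]_m, forall s, s \in S -> (x *m s.1) 0 0 <= s.2) \/
  (exists2 c, c < 0 & P 0 c).
Proof.
elim: k S => [|k IH] S SP S0.
  have [/hasP[s sS s0]|/hasPn Sge] := boolP (has (fun s => s.2 < 0) S).
    right; exists s.2 => //; have <- : s.1 = 0; last exact: SP.
    by apply/matrixP => i j; rewrite ord1 S0 // mxE.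
  by left; exists 0 => s /Sge; rewrite mul0mx mxE -leNgt.
have [km|mk] := ltnP k m; last first.
  apply: IH => // s i _ ki; have := leq_trans mk ki.
  by rewrite leqNgt ltn_ord.
pose i0 := Ordinal km.
pose pos : seq ('cV[F]_m * F) := [seq s : 'cV[F]_m * F <- S | 0 < s.1 i0 0].
pose neg : seq ('cV[F]_m * F) := [seq s : 'cV[F]_m * F <- S | s.1 i0 0 < 0].
(* For [p] in [pos] and [q] in [neg] both weights are positive, and coordinate [i0] cancels. *)
pose comb (p q : 'cV[F]_m * F) : 'cV[F]_m * F :=
  (- q.1 i0 0 *: p.1 + p.1 i0 0 *: q.1,
  - q.1 i0 0 * p.2 + p.1 i0 0 * q.2).
pose S' : seq ('cV[F]_m * F) :=
  [seq s : 'cV[F]_m * F <- S | s.1 i0 0 == 0] ++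
  [seq comb p q | p <- pos, q <- neg].
have [||[x xS']|] := IH S'; last by right.
- move=> s; rewrite mem_cat => /orP[|/allpairsP[[p q] /= [pS qS ->]]].
    by rewrite mem_filter => /andP[_]; exact: SP.
  move: pS qS; rewrite !mem_filter => /andP[p0 pS] /andP[q0 qS].
  by apply: PD; apply: PZ; rewrite ?oppr_gt0 //; apply: SP.
- move=> s i sS' ki; have [ii0|ii0] := eqVneq i i0.
    rewrite ii0; move: sS'; rewrite mem_cat => /orP[|].
      by rewrite mem_filter => /andP[/eqP].
    by move=> /allpairsP[[p q] /= [_ _ ->]]; rewrite !mxE; ring.
  have ki' : (k < i)%N by rewrite ltn_neqAle ki andbT eq_sym.
  move: sS'; rewrite mem_cat => /orP[|/allpairsP[[p q] /= [pS qS ->]]].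
    by rewrite mem_filter => /andP[_ sS]; exact: S0.
  move: pS qS; rewrite !mem_filter => /andP[p0 pS] /andP[q0 qS].
  by rewrite !mxE (S0 p i) // (S0 q i) // !mulr0 addr0.
(* These bound a shift [t] of the entry of [x] at [i0], not the new entry itself. Dividing by a
   negative coefficient reverses the inequality, so [neg] gives the lower bounds; they lie below the
   upper ones because [x] satisfies every [comb p q]. *)
left; pose bnd (s : 'cV[F]_m * F) := (s.2 - (x *m s.1) 0 0) / s.1 i0 0.
have [|t [tneg tpos]] :=
    exists_between_seqs [seq bnd s | s <- neg] [seq bnd s | s <- pos].
  move=> _ _ /mapP[q qS ->] /mapP[p pS ->].
  have /xS' : comb p q \in S'.
    by rewrite mem_cat; apply/orP; right; apply/allpairsP; exists (p, q).
  move: pS qS; rewrite !mem_filter => /andP[p0 _] /andP[q0 _].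
  rewrite /comb /= mulmxDr -!scalemxAr [leLHS]mxE.
  rewrite [X in X + _]mxE [X in _ + X]mxE => H.
  rewrite /bnd ler_pdivlMr // mulrAC ler_ndivrMr //; lra.
exists (x + t *: delta_mx 0 i0) => s sS; rewrite mulmx_delta_col.
have [s0|s0|s0] := ltgtP (s.1 i0 0) 0.
- have : bnd s <= t by apply/tneg/map_f; rewrite mem_filter s0.
  by rewrite /bnd ler_ndivrMr // lerBrDl.
- have : t <= bnd s by apply/tpos/map_f; rewrite mem_filter s0.
  by rewrite /bnd ler_pdivlMr // lerBrDl.
- by rewrite s0 mulr0 addr0; apply: xS'; rewrite mem_cat mem_filter s0 eqxx sS.
Qed.

(** * Support functions of intervals *)

Definition interval_support {F : realFieldType} (a b t : F) : F :=
  a * ((t - `|t|) / 2) + b * ((t + `|t|) / 2).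

(** With midpoint and half-length as coefficients, homogeneity and subadditivity reduce to those of
    the absolute value. *)
Lemma interval_supportE {F : realFieldType} (a b t : F) :
  interval_support a b t = (a + b) / 2 * t + (b - a) / 2 * `|t|.
Proof. by rewrite /interval_support; field. Qed.

Lemma interval_support0 {F : realFieldType} (a b : F) :
  interval_support a b 0 = 0.
Proof. by rewrite interval_supportE normr0 !mulr0 addr0. Qed.

Lemma interval_support1 {F : realFieldType} (a b : F) :
  interval_support a b 1 = b.
Proof. by rewrite interval_supportE normr1; field. Qed.

Lemma interval_supportN1 {F : realFieldType} (a b : F) :
  interval_support a b (-1) = - a.
Proof. by rewrite interval_supportE normrN normr1; field. Qed.

Lemma interval_supportZ {F : realFieldType} (a b k t : F) : 0 <= k ->
  interval_support a b (k * t) = k * interval_support a b t.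
Proof.
by move=> k0; rewrite !interval_supportE normrM (ger0_norm k0); ring.
Qed.

Lemma interval_support_leD {F : realFieldType} (a b s t : F) : a <= b ->
  interval_support a b (s + t) <=
  interval_support a b s + interval_support a b t.
Proof.
move=> ab; rewrite !interval_supportE.
have : (b - a) / 2 * `|s + t| <= (b - a) / 2 * (`|s| + `|t|).
  by rewrite ler_wpM2l ?ler_normD // divr_ge0 // subr_ge0.
lra.
Qed.

Lemma interval_supportD {F : realFieldType} (a b s t : F) : 0 <= s * t ->
  interval_support a b (s + t) =
  interval_support a b s + interval_support a b t.
Proof.
move=> st; rewrite !interval_supportE.
suff -> : `|s + t| = `|s| + `|t| by ring.
have [s0|s0|->] := ltgtP s 0; last by rewrite add0r normr0 add0r.
  move: st; rewrite nmulr_rge0 // => t0.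
  by rewrite !ler0_norm ?opprD ?(ltW s0) //; lra.
move: st; rewrite pmulr_rge0 // => t0.
by rewrite !ger0_norm ?(ltW s0) //; lra.
Qed.

Lemma le_interval_support {F : realFieldType} (a b x t : F) :
  a <= x <= b -> x * t <= interval_support a b t.
Proof.
move=> /andP[ax xb]; rewrite /interval_support.
have [t0|t0] := leP 0 t.
  rewrite ger0_norm // subrr mul0r mulr0 add0r.
  have -> : (t + t) / 2 = t by field.
  exact: ler_wpM2r.
rewrite ltr0_norm // subrr mul0r mulr0 addr0 opprK.
have -> : (t + t) / 2 = t by field.
by rewrite ler_wnM2r // ltW.
Qed.

(** * Separating a point from a zonotope *)

(** Elimination is applied to the bounds on x and to x A = w, each equation being split into two
    inequalities. No completeness of [F] enters, so over [rat] the solution x is rational, as the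
    Farkas relation requires. *)
Lemma zonotope_separation {F : realFieldType} {m n} (A : 'M[F]_(m, n))
    (a b : 'I_m -> F) (w : 'rV[F]_n) : (forall i, a i <= b i) ->
  (exists x : 'rV[F]_m, (forall i, a i <= x 0 i <= b i) /\ w = x *m A) \/
  (exists u : 'cV[F]_n,
     \sum_i interval_support (a i) (b i) ((A *m u) i 0) < (w *m u) 0 0).
Proof.
move=> ab.
(* The inequality x r <= c follows from the equations, taken with multipliers - [u], and from
   bounding x (r + A u) by the support function of the box. For r = 0 and c < 0 this is strict
   separation. *)
pose P (r : 'cV[F]_m) (c : F) := exists u : 'cV[F]_n,
  \sum_i interval_support (a i) (b i) ((r + A *m u) i 0) <= c + (w *m u) 0 0.
pose upper := [seq (delta_mx i 0 : 'cV[F]_m, b i) | i <- enum 'I_m].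
pose lower := [seq (- delta_mx i 0 : 'cV[F]_m, - a i) | i <- enum 'I_m].
pose eqle := [seq (col j A, w 0 j) | j <- enum 'I_n].
pose eqge := [seq (- col j A, - w 0 j) | j <- enum 'I_n].
have Pdelta (s : F) i : P (s *: delta_mx i 0) (interval_support (a i) (b i) s).
  exists 0; rewrite !mulmx0 addr0 mxE addr0 (bigD1 i) //= big1 => [|j ji].
    by rewrite !mxE !eqxx mulr1 addr0.
  by rewrite !mxE (negPf ji) mulr0 interval_support0.
have Pcol (s : F) j : P (s *: col j A) (s * w 0 j).
  exists (- s *: delta_mx j 0).
  rewrite -!scalemxAr -!colE scaleNr subrr big1 => [|i _].
    by rewrite !mxE mulNr subrr.
  by rewrite mxE interval_support0.
have [||||[x xS]|[c c0 [u]]] :=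
    fourier_motzkin P _ _ m (upper ++ lower ++ eqle ++ eqge).
- move=> r r' c c' [u Hu] [u' Hu']; exists (u + u').
  rewrite !mulmxDr addrACA mxE [leRHS]addrACA; apply: le_trans (lerD Hu Hu').
  rewrite -big_split ler_sum // => i _; rewrite mxE.
  exact: interval_support_leD.
- move=> t r c t0 [u Hu]; exists (t *: u).
  rewrite -!scalemxAr -scalerDr [X in _ <= _ + X]mxE -mulrDr.
  apply: le_trans (ler_wpM2l (ltW t0) Hu).
  rewrite mulr_sumr ler_sum // => i _.
  by rewrite mxE interval_supportZ // ltW.
- move=> s; rewrite !mem_cat => /or4P[] /mapP[i _ ->] /=.
  + by have := Pdelta 1 i; rewrite scale1r interval_support1.
  + by have := Pdelta (-1) i; rewrite scaleN1r interval_supportN1.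
  + by have := Pcol 1 i; rewrite scale1r mul1r.
  + by have := Pcol (-1) i; rewrite scaleN1r mulN1r.
- by move=> s i _; rewrite leqNgt ltn_ord.
- left; exists x; split=> [i|].
    have /xS : (delta_mx i 0, b i) \in upper ++ lower ++ eqle ++ eqge.
      by rewrite mem_cat map_f ?mem_enum.
    have /xS : (- delta_mx i 0, - a i) \in upper ++ lower ++ eqle ++ eqge.
      by rewrite !mem_cat (map_f (fun i => (- delta_mx i 0, - a i)))
        ?mem_enum ?orbT.
    by rewrite /= mulmxN -colE !mxE lerN2 => -> ->.
  apply/matrixP => k j; rewrite ord1.
  have /xS : (col j A, w 0 j) \in upper ++ lower ++ eqle ++ eqge.
    by rewrite !mem_cat (map_f (fun j => (col j A, w 0 j))) ?mem_enum ?orbT.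
  have /xS : (- col j A, - w 0 j) \in upper ++ lower ++ eqle ++ eqge.
    by rewrite !mem_cat (map_f (fun j => (- col j A, - w 0 j))) ?mem_enum ?orbT.
  rewrite /= mulmxN colE mulmxA -colE !mxE lerN2 => h1 h2.
  by apply/eqP; rewrite eq_le h1 h2.
- rewrite add0r => Hu; right; exists u; apply: (le_lt_trans Hu).
  by rewrite gtrDr.
Qed.

(** * The real span W and the projection onto it *)

Section RealSpan.
Variable R : realType.

Lemma dot_mulmx {n} (x y : 'rV[R]_n) : dot x y = (x *m y^T) 0 0.
Proof. by rewrite mxE; apply: eq_bigr => j _; rewrite mxE. Qed.

Lemma dotDl {n} (x y z : 'rV[R]_n) : dot (x + y) z = dot x z + dot y z.
Proof. by rewrite !dot_mulmx mulmxDl mxE. Qed.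

Lemma dotZl {n} t (x z : 'rV[R]_n) : dot (t *: x) z = t * dot x z.
Proof. by rewrite !dot_mulmx -scalemxAl mxE. Qed.

Lemma dot_sumZr {n} (I : finType) (c : I -> R) (y : I -> 'rV[R]_n) x :
  dot x (\sum_i c i *: y i) = \sum_i c i * dot x (y i).
Proof.
under [RHS]eq_bigr do rewrite mulr_sumr.
rewrite exchange_big; apply: eq_bigr => j _.
by rewrite summxE mulr_sumr; apply: eq_bigr => i _; rewrite mxE mulrCA.
Qed.

Lemma dot_eq0 {n} (x : 'rV[R]_n) : (dot x x == 0) = (x == 0).
Proof.
apply/eqP/eqP => [x0|->]; last by rewrite dot_mulmx mul0mx mxE.
apply/matrixP => i j; rewrite ord1 mxE; apply/eqP.
have := @psumr_eq0P _ _ xpredT _ (fun j _ => sqr_ge0 (x 0 j)) x0 j isT.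
by move/eqP; rewrite sqrf_eq0.
Qed.

Context {m n : nat} (v : 'I_m -> 'rV[int]_n).
Local Notation e i := (emb R (v i)).

Lemma mem_real_span (u : 'rV[R]_n) :
  u \in real_span R v <-> exists c : 'I_m -> R, u = \sum_i c i *: e i.
Proof.
split=> [/memv_sumP[x xV ->]|[c ->]].
  have /choice[c cx] : forall i, exists k, x i = k *: e i.
    by move=> i; apply/vlineP/xV.
  by exists c; apply: eq_bigr.
by apply: memv_suml => i _; rewrite memvZ // memvE (sumv_sup i).
Qed.

(** A combination of the [e i] orthogonal to all of them is orthogonal to itself. *)
Lemma real_span_nondeg (u : 'rV[R]_n) :
  u \in real_span R v -> (forall i, dot u (e i) = 0) -> u = 0.
Proof.
move=> /mem_real_span[c cu] u0; apply/eqP; rewrite -dot_eq0 {2}cu dot_sumZr.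
by rewrite big1 // => i _; rewrite u0 mulr0.
Qed.

(* Orthogonal projection: the Gram matrix V V^T has the same column space
   as V. *)
Lemma real_span_proj (u : 'rV[R]_n) :
  exists2 u0, u0 \in real_span R v & forall i, dot u0 (e i) = dot u (e i).
Proof.
pose V : 'M[R]_(m, n) := \matrix_(i, j) e i 0 j.
have rowV i : row i V = e i by apply/rowP => j; rewrite !mxE.
have VG : (V^T <= V *m V^T)%MS.
  rewrite submxE; set K := cokermx _; apply/eqP/matrixP => i j.
  (* The square norm of [x] is a diagonal entry of K^T V V^T K, and V V^T K = 0. *)
  pose x := row j (V^T *m K)^T.
  suff /eqP : x == 0 by move/rowP/(_ i); rewrite !mxE.
  rewrite -dot_eq0 dot_mulmx /x tr_row trmxK trmx_mul trmxK colE -row_mul.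
  rewrite -[trmx K *m _ *m _]mulmxA [V *m _]mulmxA [V *m (_ *m _)]mulmxA.
  by rewrite mulmx_coker mul0mx mulmx0 row0 mxE.
have /submxP[y yE] : (u *m V^T <= V *m V^T)%MS.
  by apply: submx_trans VG; apply: submxMl.
exists (y *m V).
  by apply/mem_real_span; exists (y 0); rewrite mulmx_sum_row;
    under eq_bigr do rewrite rowV.
move=> i; have /matrixP/(_ 0 i) := yE; rewrite mulmxA => uy.
rewrite !dot_mulmx -!rowV !tr_row !colE !mulmxA -!colE !mxE.
by move: uy; rewrite !mxE.
Qed.

Lemma ray_classP (u u' : nzvec R n) :
  ray_class u = ray_class u' <-> exists2 r : R, 0 < r & val u' = r *: val u.
Proof.
split=> [/eqmodP/asboolP //|?]; exact/eqmodP/asboolP.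
Qed.

(** * Conformal decompositions *)

(** Take s to be the least ratio y i / x i over the support of x: it is the largest s keeping y - s
    x conformal to x, and the minimizing coordinate becomes 0. *)
Lemma conformal_reduction (x y : 'I_m -> R) (i0 : 'I_m) :
  x i0 != 0 -> (forall i, 0 <= x i * y i) ->
  exists s, [/\ 0 <= s, forall i, 0 <= x i * (y i - s * x i) &
    exists2 i, x i != 0 & y i - s * x i = 0].
Proof.
move=> x0 xy.
have [i xi imin] :=
  @arg_minP _ R _ i0 (fun i => x i != 0) (fun i => y i / x i) x0.
have yx k : x k != 0 -> x k * y k = x k ^+ 2 * (y k / x k).
  by move=> xk; field.
exists (y i / x i); split; last by exists i => //; field.
  by have := xy i; rewrite yx // pmulr_rge0 // exprn_even_gt0.
move=> k; have [->|xk] := eqVneq (x k) 0; first by rewrite mul0r.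
have -> : x k * (y k - y i / x i * x k) = x k ^+ 2 * (y k / x k - y i / x i).
  by field; rewrite xi.
by rewrite mulr_ge0 ?sqr_ge0 // subr_ge0 imin.
Qed.

(* Minimal counterexample for the size of the support of (dot u (v i))_i: a
   decomposable u is a conic conformal combination of two vectors of smaller
   support.  If u = u' + u'', then q = u' - s u and p = u - t q do, where s and
   t are maximal such that q is conformal to u and p to q. *)
Lemma le0_real_span_of_indecomposable (g : 'rV[R]_n -> R)
    (gD : forall x y, (forall i, 0 <= dot x (e i) * dot y (e i)) ->
       g (x + y) = g x + g y)
    (gZ : forall t x, 0 <= t -> g (t *: x) = t * g x)
    (g_indec : forall u : nzvec R n, indecomposable v u -> g (val u) <= 0)
    (u : 'rV[R]_n) :
  u \in real_span R v -> g u <= 0.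
Proof.
pose supp (x : 'rV[R]_n) := [set i | dot x (e i) != 0].
have [k] := ubnP #|supp u|; elim: k u => // k IH u ltk uW.
have [->|u0] := eqVneq u 0; first by rewrite -(scale0r (0 : 'rV_n)) gZ ?mul0r.
have nz x : x \in real_span R v -> x != 0 -> exists i, dot x (e i) != 0.
  move=> xW; apply: contraNP => /forallNP x0; apply/eqP.
  by apply: real_span_nondeg => // i; apply/eqP/negPn/negP.
pose U : nzvec R n := exist _ u u0.
case: (pselect (decomposable v U)) => [|Uind]; last exact: (g_indec U).
move=> [u' [u'' [[u'W u''W] /= uE ru' _ conf]]].
have uEi i : dot u (e i) = dot (val u') (e i) + dot (val u'') (e i).
  by rewrite uE dotDl.
have [i1 ui1] := nz u uW u0.
have uu' i : 0 <= dot u (e i) * dot (val u') (e i).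
  rewrite uEi mulrDl -expr2 addr_ge0 ?sqr_ge0 // mulrC; exact: conf.
have [s [s0 uq [i2 ui2 qi2]]] :=
  @conformal_reduction (fun i => dot u (e i)) (fun i => dot (val u') (e i))
    i1 ui1 uu'.
pose q := val u' - s *: u.
have qE i : dot q (e i) = dot (val u') (e i) - s * dot u (e i).
  by rewrite /q dotDl -scaleNr dotZl mulNr.
have qW : q \in real_span R v by rewrite memvB // memvZ.
have q0 : q != 0.
  (* If q = 0 then u' = s u with s > 0, since u' is nonzero, contradicting [u'] <> [u]. *)
  apply/eqP => /subr0_eq u'E; apply: ru'; apply/ray_classP.
  have s_neq0 : s != 0.
    by apply: contra_eq_neq u'E => ->; rewrite scale0r; exact: (valP u').
  exists s^-1; first by rewrite invr_gt0 lt_def s_neq0.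
  by rewrite u'E scalerA mulVf // scale1r.
(* Where u vanishes, u' and u'' take opposite values whose product is nonnegative, so both
   vanish. *)
have supp_q i : dot u (e i) = 0 -> dot q (e i) = 0.
  move=> ui0; rewrite qE ui0 mulr0 subr0.
  have := conf i; have /esym/eqP := uEi i; rewrite ui0 addrC addr_eq0.
  move=> /eqP ->.
  by rewrite mulrN oppr_ge0 -expr2 => h; apply/eqP;
    rewrite -sqrf_eq0 eq_le h sqr_ge0.
have [i3 qi3] := nz q qW q0.
have qu i : 0 <= dot q (e i) * dot u (e i) by rewrite mulrC qE.
have [t [t0 qp [i4 qi4 pi4]]] :=
  @conformal_reduction (fun i => dot q (e i)) (fun i => dot u (e i)) i3 qi3 qu.
pose p := u - t *: q.
have pE i : dot p (e i) = dot u (e i) - t * dot q (e i).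
  by rewrite /p dotDl -scaleNr dotZl mulNr.
have pW : p \in real_span R v by rewrite memvB // memvZ.
have smaller x i : (forall j, dot u (e j) = 0 -> dot x (e j) = 0) ->
    dot u (e i) != 0 -> dot x (e i) = 0 -> (#|supp x| < k)%N.
  move=> xu ui xi; apply: leq_trans (ltnSE ltk); apply: proper_card.
  apply/properP; split.
    by apply/subsetP => j; rewrite !inE; apply: contra_neq; exact: xu.
  by exists i; rewrite inE // xi eqxx.
have gq : g q <= 0 by apply: IH => //; apply: (smaller q i2); rewrite ?qE.
have gp : g p <= 0.
  apply: IH => //; apply: (smaller p i4); last by rewrite pE.
    by move=> j uj; rewrite pE uj supp_q // mulr0 subr0.
  by apply: contra_neq qi4; exact: supp_q.
have -> : u = p + t *: q by rewrite subrK.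
rewrite gD ?gZ //; first by have := mulr_ge0_le0 t0 gq; lra.
move=> i; rewrite dotZl mulrCA mulr_ge0 // mulrC pE; exact: qp.
Qed.

End RealSpan.

(** * Passage from integers and rationals to reals *)

Lemma ratr_interval_support (R : realFieldType) (a b t : rat) :
  ratr (interval_support a b t) =
  interval_support (ratr a) (ratr b) (ratr t) :> R.
Proof.
rewrite !interval_supportE -ratr_norm.
by rewrite !(rmorphB, rmorphD, rmorphM, fmorphV, rmorph1).
Qed.

Lemma emb_sum (K : comPzRingType) {m n} (c : 'I_m -> int)
    (v : 'I_m -> 'rV[int]_n) :
  emb K (\sum_i c i *: v i) = \sum_i (c i)%:~R *: emb K (v i).
Proof.
rewrite /emb raddf_sum; apply: eq_bigr => i _.
by apply/rowP => j; rewrite !mxE /= intrM.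
Qed.

Lemma ratr_dot (R : realType) n (x : 'rV[int]_n) (u : 'cV[rat]_n) :
  ratr ((emb rat x *m u) 0 0) = dot (map_mx ratr u)^T (emb R x).
Proof.
rewrite mxE rmorph_sum; apply: eq_bigr => j _.
by rewrite rmorphM !mxE mulrC /= ratr_int.
Qed.

Theorem theorem3p2 (R : realType) (m n : nat) (v : 'I_m -> 'rV[int]_n)
    (hv : farkas_related v) (a b : 'I_m -> int) (hab : forall i, a i <= b i)
    (w : 'rV[int]_n) :
  (exists x : 'I_m -> int,
     (forall i, a i <= x i <= b i) /\ w = \sum_(i < m) x i *: v i)
  <->
  (in_int_span v w /\
   forall p : RPplus R n, indecomposable_point v p ->
   forall u : nzvec R n, ray_class u = p ->
     dot (val u) (emb R w) <=
       \sum_(i < m) (a i)%:~R *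
         ((dot (val u) (emb R (v i)) - `|dot (val u) (emb R (v i))|) / 2)
       + \sum_(i < m) (b i)%:~R *
         ((dot (val u) (emb R (v i)) + `|dot (val u) (emb R (v i))|) / 2)).
Proof.
split=> [[x [xab wE]]|[[c wE] Hind]].
  split=> [|_ _ u _]; first by exists x.
  rewrite -big_split wE emb_sum dot_sumZr ler_sum // => i _.
  by apply: le_interval_support; rewrite !ler_int.
(* The Farkas relation leaves only a rational representation of [w] to be found. *)
apply: hv => //; first by exists c.
pose A : 'M[rat]_(m, n) := \matrix_(i, j) emb rat (v i) 0 j.
have rowA i : row i A = emb rat (v i) by apply/rowP => j; rewrite !mxE.
have abQ i : (a i)%:~R <= (b i)%:~R :> rat by rewrite ler_int.
have [[x [xab wA]]|[u]] := zonotope_separation A _ _ (emb rat w) abQ.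
  exists (x 0); split=> //; rewrite wA mulmx_sum_row.
  by apply: eq_bigr => i _; rewrite rowA.
rewrite -(ltr_rat R) ratr_dot rmorph_sum => sep; exfalso; move: sep.
have [u0 u0W u0E] := real_span_proj R v (map_mx ratr u)^T.
pose g (x : 'rV[R]_n) := dot x (emb R w) -
  \sum_i interval_support (a i)%:~R (b i)%:~R (dot x (emb R (v i))).
(* Since [w] is a combination of the [v i], both sides of the separating inequality see only the
   products with the [v i], which the projection [u0] preserves. *)
have -> : dot (map_mx ratr u)^T (emb R w) = dot u0 (emb R w).
  by rewrite wE emb_sum !dot_sumZr; apply: eq_bigr => i _; rewrite u0E.
have -> : \sum_i ratr (interval_support (a i)%:~R (b i)%:~R ((A *m u) i 0)) =
    \sum_i interval_support (a i)%:~R (b i)%:~R (dot u0 (emb R (v i))).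
  apply: eq_bigr => i _; rewrite ratr_interval_support !ratr_int u0E -ratr_dot.
  by rewrite -rowA -row_mul [in RHS]mxE.
apply/negP; rewrite -leNgt -subr_le0 -/(g u0).
apply: (@le0_real_span_of_indecomposable R m n v g) => // [x y xy|t x t0|U Uind].
- rewrite /g dotDl.
  under eq_bigr do rewrite dotDl interval_supportD ?xy //.
  by rewrite big_split /=; ring.
- rewrite /g dotZl mulrBr [X in _ = _ - X]mulr_sumr.
  by congr (_ - _); apply: eq_bigr => i _; rewrite dotZl interval_supportZ.
- rewrite subr_le0 [leRHS]big_split /=.
  by apply: (Hind (ray_class U)) => //; exists U.
Qed.
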